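(* Let $G$ be a finite simple graph that has a unique perfect matching $M$ and has no vertex of degree $1$. Then $G$ contains a subgraph $H$ which is an odd dumbbell such that $M\cap E(H)$ is a perfect matching of $H$.
   Context: An odd dumbbell is a graph consisting of two vertex-disjoint cycles of odd length together with a path of odd length joining a vertex of one cycle to a vertex of the other cycle (the path meeting the cycles only at its end vertices). *)

(* Defs.v *)
From mathcomp Require Import all_boot.

Set Implicit Arguments.
Unset Strict Implicit.
Unset Printing Implicit Defensive.

(* A finite simple graph whose vertices are drawn from an ambient finite type;
   an edge is the two-element set of its endpoints. Keeping the vertex set as a
   field lets a graph and its subgraphs share a type. *)
Record graph (T : finType) := Graph {
  vertices : {set T};
  edges : {set {set T}};
  edges_axiom : forall e, e \in edges -> e \subset vertices /\ #|e| = 2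
}.

Section Graphs.

Variable T : finType.
Implicit Types (G H : graph T) (M : {set {set T}}).

Definition subgraph H G : Prop :=
  vertices H \subset vertices G /\ edges H \subset edges G.

Definition degree G (v : T) : nat := #|[set e in edges G | v \in e]|.

Definition perfect_matching G M : Prop :=
  [/\ M \subset edges G, trivIset M & cover M = vertices G].

Definition unique_perfect_matching G M : Prop :=
  perfect_matching G M /\ forall M', perfect_matching G M' -> M' = M.

(* The cycle c visits its vertices in order and then returns to the first;
   its length is size c. *)
Definition cycle_edges (c : seq T) : {set {set T}} :=
  [set [set x; next c x] | x in c].

(* The path u :: p has consecutive pairs zip (u :: p) p, the longer sequence
   being truncated; its length (number of edges) is size p. *)
Definition path_edges (u : T) (p : seq T) : {set {set T}} :=
  [set [set q.1; q.2] | q in zip (u :: p) p].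

Definition odd_cycle (c : seq T) : bool := [&& uniq c, 2 < size c & odd (size c)].

Definition odd_dumbbell H : Prop :=
  exists (c1 c2 : seq T) (u : T) (p : seq T),
    [/\ odd_cycle c1, odd_cycle c2 & [disjoint c1 & c2]] /\
    uniq (u :: p) /\ odd (size p) /\
    (forall x, x \in u :: p -> (x \in c1) = (x == u)) /\
    (forall x, x \in u :: p -> (x \in c2) = (x == last u p)) /\
    vertices H = [set x in c1] :|: [set x in c2] :|: [set x in u :: p] /\
    edges H = cycle_edges c1 :|: cycle_edges c2 :|: path_edges u p.

End Graphs.

(* Main.v *)
(* A longest path v_0, ..., v_l whose first and last edges are in M and which
   alternates between M and its complement has, at each end, a further edge
   outside M, because no degree is 1; by maximality it leads back to the path,
   say to v_i from v_l and to v_j from v_0. A second perfect matching would arise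
   from an alternating cycle, so i is odd, j is even, and j < i: otherwise
   v_i ... v_l, v_0 ... v_j or v_0 ... v_i v_l ... v_j would be such a cycle.
   The path and the two chords then form the dumbbell. *)
Require Import Defs.
From mathcomp Require Import all_boot.
From mathcomp Require Import zify.
From Stdlib Require Import Classical_Prop.

Set Implicit Arguments.
Unset Strict Implicit.
Unset Printing Implicit Defensive.

(** * Perfect matchings and exchange *)

Section Matchings.

Variables (T : finType) (G : graph T).
Implicit Types (M F : {set {set T}}) (x y z : T).

Lemma edge_in_vertices x y : [set x; y] \in edges G ->
  [/\ x \in vertices G, y \in vertices G & x != y].
Proof.
case/edges_axiom => /subsetP sub; rewrite cards2 => card2.
by split; [apply: sub; rewrite set21 | apply: sub; rewrite set22 | case: eqP card2].
Qed.

Lemma edge_other_end e x : e \in edges G -> x \in e -> exists y, e = [set x; y].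
Proof.
case/edges_axiom => _ /eqP/cards2P[a [b [_ ->]]].
by rewrite !inE => /orP[] /eqP ->; [exists b | exists a; rewrite setUC].
Qed.

Lemma set2_inj x y z : [set x; y] = [set x; z] -> y = z.
Proof.
move=> eq_xyz; have: y \in [set x; z] by rewrite -eq_xyz set22.
have: z \in [set x; y] by rewrite eq_xyz set22.
by rewrite !inE => /orP[] /eqP + /orP[] /eqP; congruence.
Qed.

(** An edge containing [x] has the form [[set x; y]], so disjointness of the edges of [M] becomes
    uniqueness of partners, and covering becomes their existence. *)
Lemma perfect_matchingP M : M \subset edges G ->
  (perfect_matching G M <->
   (forall x y z, [set x; y] \in M -> [set x; z] \in M -> y = z) /\
   (forall x, x \in vertices G -> exists y, [set x; y] \in M)).
Proof.
move=> /[dup] sub /subsetP subM; split=> [[_ triv covM] | [fun_M cov_M]].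
  split=> [x y z Mxy Mxz | x].
    apply: (@set2_inj x); rewrite -(def_pblock triv Mxy (set21 x y)).
    exact: def_pblock triv Mxz (set21 x z).
  rewrite -covM => /bigcupP[e Me /(edge_other_end (subM e Me))[y def_e]].
  by exists y; rewrite -def_e.
split=> //.
  apply/trivIsetP => e f Me Mf; apply: contraR => /pred0Pn[x /andP[/= xe xf]].
  have [y def_e] := edge_other_end (subM e Me) xe.
  have [z def_f] := edge_other_end (subM f Mf) xf.
  by rewrite def_e def_f (fun_M x y z) -?def_e -?def_f.
apply/setP=> x; apply/bigcupP/idP => [[e Me xe] | /cov_M[y Mxy]]; last first.
  by exists [set x; y]; rewrite ?set21.
by have [/subsetP sub_e _] := edges_axiom (subM e Me); apply: sub_e.
Qed.

(* Replacing the edges of [M] inside the vertex set of [F] by [F] gives another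
   perfect matching. *)
Lemma unique_perfect_matching_exchange M F :
  unique_perfect_matching G M -> F \subset edges G ->
  (forall x y z, [set x; y] \in F -> [set x; z] \in F -> y = z) ->
  (forall x y z, [set x; y] \in M -> [set x; z] \in F ->
     exists w, [set y; w] \in F) ->
  F \subset M.
Proof.
move=> [pmM uniqM] subF fun_F closedF; have [subM _ _] := pmM.
have /(perfect_matchingP subM)[fun_M cov_M] := pmM.
pose M' := [set e in M | [disjoint e & cover F]] :|: F.
have sub' : M' \subset edges G.
  by rewrite subUset subF andbT; apply: subset_trans subM; apply/subsetP=> e /[!inE] /andP[].
suff pm' : perfect_matching G M' by rewrite -(uniqM _ pm') subsetUr.
have FcoverF x z : [set x; z] \in F -> x \in cover F.
  by move=> Fxz; apply/bigcupP; exists [set x; z]; rewrite ?set21.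
have notF x y z : [disjoint [set x; y] & cover F] -> [set x; z] \in F -> False.
  by move=> /pred0P/(_ x) /= + /FcoverF Fx; rewrite Fx set21.
apply/(perfect_matchingP sub'); split=> [x y z | x xV].
  rewrite !inE => /orP[/andP[Mxy dis] | Fxy] /orP[/andP[Mxz dis'] | Fxz].
  - exact: fun_M Mxz.
  - by case: (notF _ _ _ dis Fxz).
  - by case: (notF _ _ _ dis' Fxy).
  - exact: fun_F Fxz.
have [/bigcupP[e Fe xe] | xNF] := boolP (x \in cover F).
  have [y def_e] := edge_other_end (subsetP subF e Fe) xe.
  by exists y; rewrite inE -def_e Fe orbT.
(* The edge of [M] at an [x] outside [cover F] survives: if its other end [y] were covered,
   [closedF] would give an edge of [F] at [x]. *)
have [y Mxy] := cov_M x xV; exists y; rewrite !inE Mxy /=; apply/orP; left.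
apply: contraR xNF => /pred0Pn[z /andP[/=]]; rewrite !inE => /orP[] /eqP-> //.
case/bigcupP=> e Fe ye; have [w def_e] := edge_other_end (subsetP subF e Fe) ye.
move: Mxy; rewrite setUC => /closedF; rewrite def_e in Fe => /(_ _ Fe)[w' Fxw'].
exact: FcoverF Fxw'.
Qed.

End Matchings.

(** * Edges of cycles and paths described by indices *)

Section ConsecutiveVertices.

Variables (T : finType) (v : nat -> T).

Lemma cycle_edges_map_iota a n e : uniq [seq v t | t <- iota a n.+1] ->
  e \in cycle_edges [seq v t | t <- iota a n.+1] <->
  (exists2 t, a <= t < a + n & e = [set v t; v t.+1]) \/ e = [set v (a + n); v a].
Proof.
move=> uniq_c; set c := map v _ in uniq_c *.
have next_v t : a <= t <= a + n ->
    v t \in c /\ next c (v t) = if t == a + n then v a else v t.+1.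
  move=> /andP[le_at le_tn].
  have lt_t : t - a < size (iota a n.+1) by rewrite size_iota; lia.
  have def_vt : v t = nth (v a) c (t - a).
    by rewrite (nth_map 0) // nth_iota ?subnKC //; lia.
  have vt_c : v t \in c by rewrite def_vt mem_nth ?size_map.
  split=> //; rewrite next_nth vt_c {2}def_vt index_uniq ?size_map //=.
  (* [next] looks up the tail of the cycle with its head as default value; at the last vertex this
     default [v a] is returned. *)
  case: eqP => [-> | tn]; first by rewrite nth_default // size_map size_iota; lia.
  by rewrite (nth_map 0) ?size_iota ?nth_iota; try lia; congr v; lia.
split=> [/imsetP[_ /mapP[t + ->] ->] | [[t lt_t ->] | ->]].
- rewrite mem_iota addnS ltnS => lt_t; have [_ ->] := next_v t lt_t.
  by case: eqP => [->|tn]; [right | left; exists t => //; lia].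
- have [|vt_c def_n] := next_v t; first lia.
  apply/imsetP; exists (v t) => //; rewrite def_n ifN //; lia.
- have [|vt_c def_n] := next_v (a + n); first lia.
  by apply/imsetP; exists (v (a + n)) => //; rewrite def_n eqxx.
Qed.

Lemma path_edges_map_iota a n e :
  e \in path_edges (v a) [seq v t | t <- iota a.+1 n] <->
  exists2 t, a <= t < a + n & e = [set v t; v t.+1].
Proof.
have zipP q : q \in zip (v a :: [seq v t | t <- iota a.+1 n]) [seq v t | t <- iota a.+1 n] <->
    exists2 t, a <= t < a + n & q = (v t, v t.+1).
  elim: n a => [|n IHn] a; first by split=> // -[t]; lia.
  pose r := [seq v t | t <- iota a.+2 n].
  rewrite (_ : zip _ _ = (v a, v a.+1) :: zip (v a.+1 :: r) r) //.
  rewrite inE {}/r; split=> [/orP[/eqP-> | /IHn[t lt_t ->]] | [t lt_t def_q]].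
  - by exists a => //; lia.
  - by exists t => //; lia.
  - case: (eqVneq t a) => [def_t | ta]; first by rewrite def_q def_t eqxx.
    by rewrite (IHn a.+1).2 ?orbT //; exists t => //; lia.
split=> [/imsetP[_ /zipP[t lt_t ->] ->] | [t lt_t ->]]; first by exists t.
by apply/imsetP; exists (v t, v t.+1) => //; apply/zipP; exists t.
Qed.

End ConsecutiveVertices.

(** * Alternating paths, reversal and extension *)

Section AlternatingPaths.

Variables (T : finType) (G : graph T) (M : {set {set T}}).
Variable x0 : T.
Implicit Types s : seq T.

Ltac if_lia :=
  repeat match goal with
  | |- context [if ?b then _ else _] =>
    lazymatch b with
    | context [if _ then _ else _] => fail
    | _ => let E := fresh "E" in case E: b
    end
  end; lia.

(** Swaps [2k] and [2k+1], the positions of the two ends of an edge of [M] on a path that starts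
    with such an edge. *)
Definition mate (t : nat) : nat := if odd t then t.-1 else t.+1.

Definition alternating_path s : Prop :=
  [/\ uniq s, ~~ odd (size s),
      forall t, t < size s -> [set nth x0 s t; nth x0 s (mate t)] \in M
    & forall t, t.+1 < size s -> [set nth x0 s t; nth x0 s t.+1] \in edges G].

(** As the size is even, reversing positions commutes with [mate]. This carries results about the
    last vertex over to the first. *)
Lemma alternating_path_rev s : alternating_path s -> alternating_path (rev s).
Proof.
case=> uniq_s even_s mate_s edge_s; split; rewrite ?rev_uniq ?size_rev // => t lt_t.
  have lt_mt : mate t < size s by rewrite /mate; if_lia.
  rewrite !nth_rev //; have := mate_s (size s - t.+1).
  have -> : mate (size s - t.+1) = size s - (mate t).+1 by rewrite /mate; if_lia.
  by apply; lia.
rewrite !nth_rev; try lia.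
have := edge_s (size s - t.+2).
have -> : (size s - t.+2).+1 = size s - t.+1 by lia.
by rewrite setUC; apply; lia.
Qed.

Hypothesis M_unique : unique_perfect_matching G M.

Let pmM : perfect_matching G M := proj1 M_unique.

Let subM : M \subset edges G.
Proof. by case: pmM. Qed.

Let M_fun x y z : [set x; y] \in M -> [set x; z] \in M -> y = z.
Proof. by have /(perfect_matchingP subM)[+ _] := pmM; apply. Qed.

Let M_cov x : x \in vertices G -> exists y, [set x; y] \in M.
Proof. by have /(perfect_matchingP subM)[_ +] := pmM; apply. Qed.

Lemma alternating_path_cat s w z : alternating_path s ->
  [set w; z] \in M -> w \notin s -> z \notin s ->
  [set nth x0 s (size s).-1; w] \in edges G -> alternating_path (s ++ [:: w; z]).
Proof.
case=> uniq_s even_s mate_s edge_s Mwz wNs zNs Elw.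
have [_ _ neq_wz] := edge_in_vertices (subsetP subM _ Mwz).
split; rewrite ?size_cat /=.
- by rewrite cat_uniq uniq_s /= inE neq_wz (negPf wNs) (negPf zNs).
- by rewrite oddD addbF.
- move=> t lt_t; rewrite !nth_cat; case: (ltnP t (size s)) => [lt_ts | le_st].
    have -> : mate t < size s by rewrite /mate; if_lia.
    exact: mate_s.
  have [->|->] : t = size s \/ t = (size s).+1 by lia.
    by rewrite /mate (negPf even_s) ltnNge leqnSn subnn subSnn.
  by rewrite /mate /= even_s /= ltnn subnn subSnn setUC.
- move=> t lt_t; rewrite !nth_cat; case: (ltnP t.+1 (size s)) => [lt_ts | le_st].
    by rewrite ltnW // edge_s.
  case: (ltnP t (size s)) => le_st'.
    have def_s : size s = t.+1 by lia.
    by rewrite def_s subnn; rewrite def_s in Elw.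
  have -> : t = size s by lia.
  by rewrite subnn subSnn; apply: (subsetP subM).
Qed.

(** * Chords from the ends of an alternating path *)

Section AlternatingPath.

Variable s : seq T.
Hypothesis alt_s : alternating_path s.
Let v := nth x0 s.

Let uniq_s : uniq s.
Proof. by case: alt_s. Qed.

Let even_s : ~~ odd (size s).
Proof. by case: alt_s. Qed.

Let v_inj a b : a < size s -> b < size s -> v a = v b -> a = b.
Proof. by move=> la lb /eqP; rewrite nth_uniq // => /eqP. Qed.

Let mate_s t : t < size s -> [set v t; v (mate t)] \in M.
Proof. by case: alt_s => _ _ + _; apply. Qed.

Let edge_s t : t.+1 < size s -> [set v t; v t.+1] \in edges G.
Proof. by case: alt_s => _ _ _; apply. Qed.

Let mate_lt t : t < size s -> mate t < size s.
Proof. by rewrite /mate; have := even_s; if_lia. Qed.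

(* The involution [f] on the index set [I], paired with [mate], describes a
   disjoint union of alternating cycles. *)
Lemma no_alternating_cycle (I : pred nat) (f : nat -> nat) t0 :
  (forall t, I t -> [/\ t < size s, I (mate t), I (f t), f (f t) = t
                      & [set v t; v (f t)] \in edges G]) ->
  I t0 -> f t0 = mate t0.
Proof.
move=> If It0.
pose F := [set [set v t; v (f t)] | t : 'I_(size s) & I t].
have inF t : I t -> [set v t; v (f t)] \in F.
  move=> It; have [lt_t _ _ _ _] := If t It.
  by apply/imsetP; exists (Ordinal lt_t); rewrite ?inE.
have FP x y : [set x; y] \in F -> exists t, [/\ I t, x = v t & y = v (f t)].
  case/imsetP=> t /[!inE] It eq_xy; have [lt_t _ Ift fft _] := If t It.
  have: x \in [set v t; v (f t)] by rewrite -eq_xy set21.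
  rewrite !inE => /orP[] /eqP def_x; move: eq_xy; rewrite def_x.
    by move/set2_inj; exists t.
  by rewrite [RHS]setUC => /set2_inj ->; exists (f t); rewrite fft.
(* By uniqueness the exchange returns [M] itself, so [v (f t0)] and [v (mate t0)] are both the
   partner of [v t0]. *)
have sub_F : F \subset M.
  apply: (unique_perfect_matching_exchange M_unique).
  - by apply/subsetP=> _ /imsetP[t /[!inE] It ->]; case: (If t It).
  - move=> x y z /FP[a [Ia -> ->]] /FP[b [Ib + ->]].
    have [la _ _ _ _] := If a Ia; have [lb _ _ _ _] := If b Ib.
    by move/(v_inj la lb)->.
  - move=> x y z Mxy /FP[a [Ia def_x _]]; have [la Ima _ _ _] := If a Ia.
    exists (v (f (mate a))); rewrite def_x in Mxy.
    by rewrite (M_fun Mxy (mate_s la)) inF.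
have [lt_t Im Ift _ _] := If _ It0.
have [lt_m _ _ _ _] := If _ Im; have [lt_f _ _ _ _] := If _ Ift.
apply: v_inj => //; apply: M_fun (mate_s lt_t); exact: (subsetP sub_F _ (inF _ It0)).
Qed.

(** If [i <= j], the segments from [0] to [i] and from [j] to the end each start at an even and stop
    at an odd index, so the two chords join them into an alternating cycle. *)
Lemma alternating_path_chords_disjoint i j :
  odd i -> ~~ odd j -> 0 < j -> i.+1 < size s ->
  [set v (size s).-1; v i] \in edges G -> [set v 0; v j] \in edges G ->
  j < size s -> j < i.
Proof.
move=> odd_i even_j j_gt0 lt_i; case def_l: (size s) => [|l] /= Ei Ej lt_j.
  by rewrite def_l in lt_i.
rewrite ltnNge; apply/negP => le_ij.
have odd_l : odd l by have := even_s; rewrite def_l negbK.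
(* [f] follows the edges of that cycle outside [M]: the chords at the four segment ends, and
   elsewhere the step up from odd and down from even indices. It sends [0] to the even [j], whereas
   [mate 0] is [1]. *)
pose f t := if t == 0 then j else if t == j then 0 else
  if t == i then l else if t == l then i else if odd t then t.+1 else t.-1.
suff : f 0 = mate 0 by rewrite /f /mate /= => j1; rewrite j1 in even_j.
apply: (no_alternating_cycle (I := fun t => (t <= i) || (j <= t <= l))) => //.
move: odd_i even_j j_gt0 lt_i def_l Ei Ej lt_j le_ij odd_l edge_s; clear.
rewrite /f; clear f.
move=> odd_i even_j j_gt0 lt_i def_l Ei Ej lt_j le_ij odd_l edge_s t It.
split; rewrite /mate ?def_l; try if_lia.
case: eqP => [-> // | t0].
case: eqP => [-> | tj]; first by rewrite setUC.
case: eqP => [-> | ti]; first by rewrite setUC.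
case: eqP => [-> // | tl].
case: ifP => odd_t; first by apply: edge_s; lia.
case: t => [|t] in It t0 tj ti tl odd_t *; first by lia.
by rewrite setUC; apply: edge_s; lia.
Qed.

(** The chords close the segments [0..j] and [i..l] into cycles of lengths [j + 1] and [l - i + 1],
    and the segment [j..i] of length [i - j] joins them; all three are odd. *)
Lemma alternating_path_dumbbell i j :
  odd i -> ~~ odd j -> 0 < j -> j < i -> i.+1 < size s ->
  [set v (size s).-1; v i] \in edges G -> [set v 0; v j] \in edges G ->
  exists H : graph T,
    [/\ subgraph H G, odd_dumbbell H & perfect_matching H (M :&: edges H)].
Proof.
move=> odd_i even_j j_gt0 lt_ji; case def_l: (size s) => [|l] //= lt_il Ei Ej.
rewrite ltnS in lt_il.
have odd_l : odd l by have := even_s; rewrite def_l negbK.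
(* Packed so that [lia], which is slow on parities, does not see them. *)
have parity : [/\ odd i, ~~ odd j & odd l] by [].
clear odd_i even_j odd_l even_s.
pose seg a n := [seq v t | t <- iota a n].
have mem_seg a n t : t <= l -> a + n <= l.+1 -> (v t \in seg a n) = (a <= t < a + n).
  move=> le_tl le_an; rewrite -mem_iota; apply/mapP/idP => [[b b_in] | t_in]; last by exists t.
  by move/v_inj->; rewrite // def_l; move: b_in; rewrite mem_iota; lia.
have uniq_seg a n : a + n <= l.+1 -> uniq (seg a n).
  move=> le_an; rewrite map_inj_in_uniq ?iota_uniq // => b b'.
  by rewrite !mem_iota => lb lb'; apply: v_inj; rewrite def_l; lia.
have mem_s x : x \in s -> exists2 t, t <= l & x = v t.
  move=> xs; exists (index x s); last by rewrite /v nth_index.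
  by rewrite -ltnS -def_l index_mem.
have v_s t : t <= l -> v t \in s by move=> le_tl; rewrite mem_nth // def_l.
(* The second argument of [seg] counts vertices. [p] leaves out its origin [v j], so its size is the
   number of edges of the joining path. *)
pose c1 := seg 0 j.+1; pose c2 := seg i (l - i).+1; pose p := seg j.+1 (i - j).
have up_seg : v j :: p = seg j (i - j).+1 by [].
pose E := cycle_edges c1 :|: cycle_edges c2 :|: path_edges (v j) p.
(* Cut at [j] and [i], the consecutive pairs of the whole path are shared out among the three
   pieces; only the two chords remain. *)
have EP e : e \in E <-> [\/ exists2 t, t < l & e = [set v t; v t.+1],
    e = [set v j; v 0] | e = [set v l; v i]].
  have [u1 u2] : uniq c1 /\ uniq c2 by split; apply: uniq_seg; lia.
  rewrite !inE; split=> [/orP[/orP[]|] | ].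
  - case/(cycle_edges_map_iota _ u1) => [[t lt_t ->]|->]; last exact: Or32.
    by apply: Or31; exists t => //; lia.
  - case/(cycle_edges_map_iota _ u2) => [[t lt_t ->]|->].
      by apply: Or31; exists t => //; lia.
    by rewrite subnKC 1?ltnW //; apply: Or33.
  - by case/path_edges_map_iota=> t lt_t ->; apply: Or31; exists t => //; lia.
  - case=> [[t lt_t ->]|->|->].
    + case: (ltnP t j) => [lt_tj | le_jt].
        apply/orP; left; apply/orP; left.
        by apply/(cycle_edges_map_iota _ u1); left; exists t.
      case: (ltnP t i) => [lt_ti | le_it].
        apply/orP; right; apply/path_edges_map_iota; exists t => //; lia.
      apply/orP; left; apply/orP; right.
      by apply/(cycle_edges_map_iota _ u2); left; exists t => //; lia.
    + by apply/orP; left; apply/orP; left; apply/(cycle_edges_map_iota _ u1); right.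
    + apply/orP; left; apply/orP; right; apply/(cycle_edges_map_iota _ u2); right.
      by rewrite subnKC //; lia.
have sub_E : E \subset edges G.
  apply/subsetP=> e /EP[[t lt_t ->]|->|->] //; last by rewrite setUC.
  by apply: edge_s; rewrite def_l.
have E_axiom e : e \in E -> e \subset [set x in s] /\ #|e| = 2.
  move=> Ee; split; last by case: (edges_axiom (subsetP sub_E e Ee)).
  by apply/subsetP=> x; rewrite inE; case/EP: Ee => [[t lt_t ->]|->|->];
    rewrite !inE => /orP[] /eqP->; apply: v_s; lia.
exists (Graph E_axiom); split.
- split=> //=; apply/subsetP=> x; rewrite inE => /mem_s[t le_tl ->].
  have /mate_s/(subsetP subM)/edge_in_vertices[] // : t < size s by rewrite def_l.
- exists c1, c2, (v j), p; split; [split | do ![split]] => //=.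
  + by rewrite /odd_cycle uniq_seg ?size_map ?size_iota /=; case: parity => *; lia.
  + by rewrite /odd_cycle uniq_seg ?size_map ?size_iota /=; case: parity => *; lia.
  + apply/pred0P=> x; apply/negP => /andP[/= /mapP[t]]; rewrite mem_iota => lt_t ->.
    by rewrite mem_seg; lia.
  + by rewrite -/(uniq (_ :: _)) up_seg uniq_seg //; lia.
  + by rewrite size_map size_iota; case: parity => *; lia.
  + move=> x; rewrite up_seg => /mapP[t]; rewrite mem_iota => lt_t ->.
    rewrite mem_seg; try lia; apply/idP/eqP => [lt_t' | /v_inj]; first by congr v; lia.
    by rewrite def_l; lia.
  + have -> : last (v j) p = v i.
      rewrite last_map (last_nth j) size_iota -[j :: _]/(iota j (i - j).+1).
      by rewrite nth_iota ?subnKC // ltnW.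
    move=> x; rewrite up_seg => /mapP[t]; rewrite mem_iota => lt_t ->.
    rewrite mem_seg; try lia; apply/idP/eqP => [lt_t' | /v_inj]; first by congr v; lia.
    by rewrite def_l; lia.
  + apply/setP=> x; rewrite up_seg !in_setU !in_set; apply/idP/idP.
      by move/mem_s => [t le_tl ->]; rewrite !mem_seg; lia.
    by move=> /orP[/orP[]|] /mapP[t]; rewrite mem_iota => lt_t ->; apply: v_s; lia.
have sub_M : M :&: E \subset E by apply: subsetIr.
apply/(@perfect_matchingP _ (Graph E_axiom)) => //; split=> [x y z|x].
  by rewrite !inE => /andP[Mxy _] /andP[Mxz _]; apply: M_fun Mxz.
rewrite inE => /mem_s[t le_tl ->]; exists (v (mate t)).
(* [t] and [mate t] are consecutive, so the edge of [M] at [v t] belongs to [E]. *)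
rewrite inE mate_s ?def_l //=; apply/EP/Or31; rewrite /mate; case: ifP => odd_t.
  by case: t => [//|t] in le_tl odd_t *; exists t; last rewrite setUC.
by exists t => //; case: parity => *; lia.
Qed.

Hypothesis s_neq0 : s != [::].
Hypothesis no_deg1 : forall x, x \in vertices G -> degree G x <> 1.
Hypothesis s_max : forall s', alternating_path s' -> size s' <= size s.

(** The last vertex has an edge outside [M], since its degree is not 1. Maximality puts the other
    end on the path, and an even index there would close an alternating cycle. *)
Lemma maximal_alternating_path_end :
  exists i, [/\ odd i, i.+1 < size s & [set v (size s).-1; v i] \in edges G].
Proof.
have [l def_l] : exists l, size s = l.+1.
  by exists (size s).-1; rewrite prednK //; case: (s) s_neq0.
rewrite def_l /=; have lt_l : l < size s by rewrite def_l.
have odd_l : odd l by have := even_s; rewrite def_l negbK.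
have Ml := mate_s lt_l; have El := subsetP subM _ Ml.
have [lV _ _] := edge_in_vertices El.
have [w Ew wNmate] : exists2 w, [set v l; w] \in edges G & w <> v (mate l).
  have [e /andP[Ee ve] eN] : exists2 e,
      (e \in edges G) && (v l \in e) & e != [set v l; v (mate l)].
    have := no_deg1 lV; rewrite /degree (cardsD1 [set v l; v (mate l)]).
    rewrite !inE El eqxx /= add1n => /eqP; rewrite eqSS cards_eq0.
    by case/set0Pn=> e /[!inE] /andP[? ?]; exists e.
  have [w def_e] := edge_other_end Ee ve; exists w; rewrite -?def_e //.
  by move=> eq_w; rewrite def_e eq_w eqxx in eN.
have [_ wV neq_lw] := edge_in_vertices Ew.
(* The path contains the partner of each of its vertices, so if [w] is off the path, so is its
   partner [z], and appending both gives a longer alternating path. *)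
have w_s : w \in s.
  apply/negPn/negP => wNs; have [z Mwz] := M_cov wV.
  have zNs : z \notin s.
    apply/negP => zs; rewrite -(nth_index x0 zs) -/v in Mwz.
    have lz : index z s < size s by rewrite index_mem.
    move: Mwz; rewrite setUC => /M_fun/(_ (mate_s lz)) def_w.
    by case/negP: wNs; rewrite def_w mem_nth ?mate_lt.
  have /s_max : alternating_path (s ++ [:: w; z]).
    by apply: alternating_path_cat; rewrite ?def_l.
  by rewrite size_cat addn2 ltnNge leqnSn.
exists (index w s); rewrite /v nth_index //.
have lt_i : index w s < size s by rewrite index_mem.
have def_w : v (index w s) = w by rewrite /v nth_index.
set i := index w s in lt_i def_w *.
have i_neq_l : i != l by apply: contra_neq neq_lw => eq_il; rewrite -def_w eq_il.
have lt_il : i < l by rewrite ltn_neqAle i_neq_l -ltnS -def_l.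
split=> //.
apply/negPn/negP => even_i; apply: wNmate; rewrite -def_w; congr v.
(* For even [i], the segment [i..l] closed by the chord forces [i = f l = mate l], against the
   choice of [w]. *)
pose f t := if t == i then l else if t == l then i else if odd t then t.+1 else t.-1.
have <- : f l = i by rewrite /f eq_sym (negPf i_neq_l) eqxx.
apply: (no_alternating_cycle (I := fun t => i <= t <= l)); last by rewrite ltnW /=.
move: def_w lt_il even_i odd_l def_l Ew edge_s; clear.
move=> def_w lt_il even_i odd_l def_l Ew edge_s t /andP[le_it le_tl].
split; rewrite /mate /f ?def_l //; try if_lia.
case: eqP => [-> | ti]; first by rewrite def_w setUC.
case: eqP => [-> | tl]; first by rewrite def_w.
case: ifP => odd_t; first by apply: edge_s; lia.
case: t => [|t] in le_it le_tl ti tl odd_t *; first by lia.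
by rewrite setUC; apply: edge_s; lia.
Qed.

End AlternatingPath.

Lemma exists_maximal_alternating_path : x0 \in vertices G ->
  exists s, [/\ alternating_path s, s != [::]
               & forall s', alternating_path s' -> size s' <= size s].
Proof.
move=> x0V; have [y Mxy] := M_cov x0V.
have Exy := subsetP subM _ Mxy; have [_ _ neq_xy] := edge_in_vertices Exy.
have alt2 : alternating_path [:: x0; y].
  by split; rewrite /= ?inE ?neq_xy //; case=> [|[|t]] //=; rewrite setUC.
have bound s : alternating_path s -> size s <= #|T|.
  by case=> uniq_s _ _ _; rewrite -(card_uniqP uniq_s) max_card.
suff [s [alt_s le2 s_max]] : exists s, [/\ alternating_path s, 2 <= size s
    & forall s', alternating_path s' -> size s' <= size s].
  by exists s; split=> //; case: (s) le2.
(* Starting from one edge of [M], pass to a longer path while there is one; the gap to the bound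
   [#|T|] decreases. *)
have [n le_n] := ubnP (#|T| - size [:: x0; y]).
have ge2 : 2 <= size [:: x0; y] by [].
elim: n [:: x0; y] alt2 ge2 le_n => // n IHn s alt_s le2 lt_n.
have [[s' alt_s' lt_s] | no_s'] :=
    classic (exists2 s', alternating_path s' & size s < size s').
  have := bound _ alt_s' => le_T; apply: (IHn _ alt_s'); lia.
exists s; split=> // s' alt_s'; rewrite leqNgt; apply/negP => lt_s.
by apply: no_s'; exists s'.
Qed.

End AlternatingPaths.

(** * The dumbbell in a graph with a unique perfect matching *)

Theorem theorem4p4 (T : finType) (G : graph T) (M : {set {set T}})
    (G_nonempty : vertices G != set0)
    (M_unique : unique_perfect_matching G M)
    (no_deg1 : forall v, v \in vertices G -> degree G v <> 1) :
  exists H : graph T,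
    [/\ subgraph H G, odd_dumbbell H & perfect_matching H (M :&: edges H)].
Proof.
have [x0 x0V] := set0Pn _ G_nonempty.
have [s [alt_s s_neq0 s_max]] := exists_maximal_alternating_path M_unique x0V.
have [i [odd_i lt_i Ei]] := maximal_alternating_path_end M_unique alt_s s_neq0 no_deg1 s_max.
have alt_r := alternating_path_rev alt_s.
have [||k [odd_k]] := maximal_alternating_path_end M_unique alt_r _ no_deg1.
- by rewrite -size_eq0 size_rev size_eq0.
- by move=> s'; rewrite size_rev; apply: s_max.
have [_ even_s _ _] := alt_s.
rewrite size_rev => lt_k; rewrite !nth_rev; try lia.
have -> : size s - (size s).-1.+1 = 0 by lia.
(* Position [k] of [rev s] is position [j] of [s]. As the size is even, odd [k] gives even [j], and
   [k.+1 < size s] gives [0 < j]. *)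
set j := size s - k.+1 => Ej.
have [even_j j_gt0 lt_j] : [/\ ~~ odd j, 0 < j & j < size s] by rewrite /j; split; lia.
have lt_ji := alternating_path_chords_disjoint M_unique alt_s odd_i even_j j_gt0 lt_i Ei Ej lt_j.
exact (alternating_path_dumbbell M_unique alt_s odd_i even_j j_gt0 lt_ji lt_i Ei Ej).
Qed.
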